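(* For every $M\in\Lambda^{001}$ the following are equivalent: (1) there exists $N\in\Lambda^{001}$ in head normal form such that $M\longrightarrow_\beta^\infty N$; (2) there exists $s\in\mathcal T(M)$ such that $\mathrm{nf}_r(s)\neq 0$; (3) there exists $N\in\Lambda^{001}$ in head normal form such that $M\longrightarrow_h^* N$.
   Context: $\Lambda^{001}$ is the set of possibly infinite λ-terms (trees of variables, abstractions $\lambda x.M$ and applications $(M)N$) whose infinite branches all enter infinitely often the argument position of an application, up to α-equivalence; $M[N/x]$ is capture-avoiding substitution; $\longrightarrow_\beta$ is the contextual closure (finite derivations) of $(\lambda x.M)N\longrightarrow_\beta M[N/x]$ and $\longrightarrow_\beta^*$ its reflexive-transitive closure. The infinitary reduction $\longrightarrow_\beta^\infty$ is defined by the rules below, with possibly infinite derivations in which every infinite branch passes infinitely often through the third premise of (@): (var) $M\longrightarrow_\beta^* x\Rightarrow M\longrightarrow_\beta^\infty x$; (λ) $M\longrightarrow_\beta^*\lambda x.P$, $P\longrightarrow_\beta^\infty P'$ $\Rightarrow M\longrightarrow_\beta^\infty\lambda x.P'$; (@) $M\longrightarrow_\beta^*(P)Q$, $P\longrightarrow_\beta^\infty P'$, $Q\longrightarrow_\beta^\infty Q'$ $\Rightarrow M\longrightarrow_\beta^\infty(P')Q'$. A term is in head normal form if it has the form $\lambda x_1\dots\lambda x_m.(\dots((y)Q_1)\dots)Q_n$; otherwise it has the form $\lambda x_1\dots\lambda x_m.(\dots((\lambda z.N)P)Q_1\dots)Q_n$ and its head reduct is $\lambda x_1\dots\lambda x_m.(\dots((N[P/z])Q_1)\dots)Q_n$;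 $\longrightarrow_h$ is head reduction and $\longrightarrow_h^*$ its reflexive-transitive closure. Resource terms: $s::=x\mid\lambda x.s\mid\langle s\rangle\bar t$, $\bar t$ a finite multiset of resource terms; finite sums are finite sets of resource terms ($0$ the empty sum). Resource reduction: $\longmapsto_r$ is the least relation from terms (resp. monomials) to finite sums containing $\langle\lambda x.s\rangle\bar t\longmapsto_r s\langle\bar t/x\rangle$ (where, for $\bar t=[t_1,\dots,t_n]$, $s\langle\bar t/x\rangle$ is the sum over $\sigma\in\mathfrak S_n$ of the linear substitutions of $t_{\sigma(i)}$ for the $i$-th free occurrence of $x$ if $x$ occurs exactly $n$ times freely in $s$, and $0$ otherwise) and closed under all term and monomial contexts; on finite sums, $\sum_{i=0}^n s_i\longrightarrow_r\sum_{i=0}^n T_i$ when $s_0\longmapsto_r T_0$ and each other $s_i$ either reduces to $T_i$ or equals it. This reduction is confluent and weakly normalising, and $\mathrm{nf}_r(s)$ denotes the normal form of $s$. Taylor approximation $\ltimes$ is inductive: $x\ltimes x$; $s\ltimes M\Rightarrow\lambda x.s\ltimes\lambda x.M$; ($s\ltimes M$ and $t_i\ltimes N$ for all $i$) $\Rightarrow\langle s\rangle[t_1,\dots,t_n]\ltimes(M)N$; $\mathcal T(M)=\{s : s\ltimes M\}$. *)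

(* Defs.v *)
(* Infinitary lambda-terms with de Bruijn indices (so alpha-
   equivalence is built in); terms are coinductive, equality "up to alpha"
   is bisimilarity [teq]. Resource terms are inductive, bags = lists
   (multisets up to permutation), finite sums = lists (sets). *)
From Stdlib Require Import Arith List.
Import ListNotations.

CoInductive term : Type :=
| var : nat -> term
| lam : term -> term
| app : term -> term -> term.

CoInductive teq : term -> term -> Prop :=
| teq_var n : teq (var n) (var n)
| teq_lam M N : teq M N -> teq (lam M) (lam N)
| teq_app M M' N N' : teq M M' -> teq N N' -> teq (app M N) (app M' N').

(* Lambda^{001}: every infinite branch enters the argument position of an
   application infinitely often.  spine001 P M: the "spine" of M (following
   bodies of abstractions and function positions) is finite, and every
   argument met along it satisfies P. *)
Inductive spine001 (P : term -> Prop) : term -> Prop :=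
| sp_var n : spine001 P (var n)
| sp_lam M : spine001 P M -> spine001 P (lam M)
| sp_app M N : spine001 P M -> P N -> spine001 P (app M N).

Definition Lam001 (M : term) : Prop :=
  exists P : term -> Prop, P M /\ forall N, P N -> spine001 P N.

CoFixpoint shift (d c : nat) (M : term) : term :=
  match M with
  | var n => var (if n <? c then n else n + d)
  | lam P => lam (shift d (S c) P)
  | app P Q => app (shift d c P) (shift d c Q)
  end.

CoFixpoint subst (k : nat) (N : term) (M : term) : term :=
  match M with
  | var n => if n =? k then shift k 0 N
             else if n <? k then var n else var (pred n)
  | lam P => lam (subst (S k) N P)
  | app P Q => app (subst k N P) (subst k N Q)
  end.

Inductive bstep : term -> term -> Prop :=
| bs_beta P Q : bstep (app (lam P) Q) (subst 0 Q P)
| bs_lam M M' : bstep M M' -> bstep (lam M) (lam M')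
| bs_appl M M' N : bstep M M' -> bstep (app M N) (app M' N)
| bs_appr M N N' : bstep N N' -> bstep (app M N) (app M N').

Inductive bred : term -> term -> Prop :=
| bred_refl M N : teq M N -> bred M N
| bred_step M M' N : bstep M M' -> bred M' N -> bred M N.

(* infinitary reduction: mixed inductive/coinductive derivations, every
   infinite branch passes infinitely often through the argument premise *)
Inductive infstep (R : term -> term -> Prop) : term -> term -> Prop :=
| inf_var M x : bred M (var x) -> infstep R M (var x)
| inf_lam M P P' : bred M (lam P) -> infstep R P P' -> infstep R M (lam P')
| inf_app M P Q P' Q' : bred M (app P Q) -> infstep R P P' -> R Q Q' ->
    infstep R M (app P' Q').

Definition infred (M N : term) : Prop :=
  exists R : term -> term -> Prop, R M N /\ forall a b, R a b -> infstep R a b.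

Inductive head_var : term -> Prop :=
| hv_var n : head_var (var n)
| hv_app M N : head_var M -> head_var (app M N).

Inductive hnf : term -> Prop :=
| hnf_lam M : hnf M -> hnf (lam M)
| hnf_hv M : head_var M -> hnf M.

Inductive hstep : term -> term -> Prop :=
| hs_beta P Q : hstep (app (lam P) Q) (subst 0 Q P)
| hs_lam M M' : hstep M M' -> hstep (lam M) (lam M')
| hs_app M M' Q : (forall P, M <> lam P) -> hstep M M' -> hstep (app M Q) (app M' Q).

Inductive hred : term -> term -> Prop :=
| hred_refl M N : teq M N -> hred M N
| hred_step M M' N : hstep M M' -> hred M' N -> hred M N.

Inductive rterm : Type :=
| rvar : nat -> rterm
| rlam : rterm -> rterm
| rapp : rterm -> list rterm -> rterm.

Fixpoint rocc (k : nat) (s : rterm) : nat :=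
  match s with
  | rvar n => if n =? k then 1 else 0
  | rlam s => rocc (S k) s
  | rapp s ts => rocc k s +
      (fix go (l : list rterm) : nat :=
         match l with nil => 0 | t :: l => rocc k t + go l end) ts
  end.

Fixpoint rshift (d c : nat) (s : rterm) : rterm :=
  match s with
  | rvar n => rvar (if n <? c then n else n + d)
  | rlam s => rlam (rshift d (S c) s)
  | rapp s ts => rapp (rshift d c s)
      ((fix go (l : list rterm) : list rterm :=
          match l with nil => nil | t :: l => rshift d c t :: go l end) ts)
  end.

(* linear substitution: the i-th free occurrence (in left-to-right order) of
   index k receives the i-th element of the list; returns unused elements *)
Fixpoint lsubst (k : nat) (s : rterm) (ts : list rterm) : rterm * list rterm :=
  match s with
  | rvar n =>
      if n =? k then
        match ts with
        | nil => (rvar n, nil)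
        | t :: ts' => (rshift k 0 t, ts')
        end
      else if n <? k then (rvar n, ts) else (rvar (pred n), ts)
  | rlam s => let (s', ts') := lsubst (S k) s ts in (rlam s', ts')
  | rapp s us =>
      let (s', ts1) := lsubst k s ts in
      let (us', ts2) :=
        (fix go (l : list rterm) (acc : list rterm) : list rterm * list rterm :=
           match l with
           | nil => (nil, acc)
           | u :: l => let (u', a1) := lsubst k u acc in
                       let (l', a2) := go l a1 in (u' :: l', a2)
           end) us ts1 in
      (rapp s' us', ts2)
  end.

Fixpoint insert_all {A : Type} (a : A) (l : list A) : list (list A) :=
  match l with
  | nil => [[a]]
  | b :: l' => (a :: b :: l') :: map (cons b) (insert_all a l')
  end.

Fixpoint perms {A : Type} (l : list A) : list (list A) :=
  match l with
  | nil => [nil]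
  | a :: l' => flat_map (insert_all a) (perms l')
  end.

Definition rsubst0 (s : rterm) (ts : list rterm) : list rterm :=
  if rocc 0 s =? length ts then map (fun p => fst (lsubst 0 s p)) (perms ts)
  else nil.

Inductive rstep : rterm -> list rterm -> Prop :=
| rs_beta s ts : rstep (rapp (rlam s) ts) (rsubst0 s ts)
| rs_lam s T : rstep s T -> rstep (rlam s) (map rlam T)
| rs_appl s T ts : rstep s T -> rstep (rapp s ts) (map (fun s' => rapp s' ts) T)
| rs_bag s ts1 t ts2 T : rstep t T ->
    rstep (rapp s (ts1 ++ t :: ts2)) (map (fun t' => rapp s (ts1 ++ t' :: ts2)) T).

(* reduction of finite sums: at least one summand reduces, each other summand
   reduces or is kept; the boolean records whether some summand reduced *)
Inductive sreds : bool -> list rterm -> list rterm -> Prop :=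
| sr_nil : sreds false nil nil
| sr_keep b s S S' : sreds b S S' -> sreds b (s :: S) (s :: S')
| sr_red b s T S S' : rstep s T -> sreds b S S' -> sreds true (s :: S) (T ++ S').

Definition sstep (S S' : list rterm) : Prop := sreds true S S'.

Inductive sred_star : list rterm -> list rterm -> Prop :=
| ss_refl S : sred_star S S
| ss_step S S' S'' : sstep S S' -> sred_star S' S'' -> sred_star S S''.

Definition sum_normal (S : list rterm) : Prop :=
  forall s, In s S -> forall T, ~ rstep s T.

Definition nf_r (s : rterm) (S : list rterm) : Prop :=
  sred_star [s] S /\ sum_normal S.

Inductive taylor : rterm -> term -> Prop :=
| ty_var n : taylor (rvar n) (var n)
| ty_lam s M : taylor s M -> taylor (rlam s) (lam M)
| ty_app s ts M N : taylor s M -> (forall t, In t ts -> taylor t N) ->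
    taylor (rapp s ts) (app M N).

(* Main.v *)
(** Resource reduction is studied through [rto], which follows one summand of
    each reduct.  Infinitary reduction to a head normal form [N] unfolds, along
    the finite spine of [N], into finitely many finite beta reductions; these
    can be pulled back through the Taylor expansion, because a reduct's
    approximant is always a resource reduct of an approximant of the source,
    starting from the approximant of [N] all of whose bags are empty.
    Conversely a nonzero normal form of [s] gives an [rto]-path from [s] to a
    head normal form.  A non-head step followed by a head step can be turned
    into a head step followed by at most one step, so the path can be made to
    start with a head step, which the approximated infinitary term simulates;
    resource steps decrease the size, hence head reduction terminates.  No
    confluence of resource reduction is needed. *)

Require Import Defs.
From Stdlib Require Import List.
From Stdlib Require Import Arith Lia Permutation Relations Operators_Properties.
Import ListNotations Defs.

Local Arguments Nat.ltb : simpl never.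
Local Arguments Nat.eqb : simpl never.

(** * Resource terms *)

(** The members of a bag are nested under [list], and the generated induction principle gives no
    hypothesis about them. *)
Lemma rterm_nested_ind (P : rterm -> Prop) :
  (forall n, P (rvar n)) -> (forall s, P s -> P (rlam s)) ->
  (forall s ts, P s -> Forall P ts -> P (rapp s ts)) -> forall s, P s.
Proof.
  intros Hv Hl Ha. fix IH 1. intros [n | s | s ts].
  - apply Hv.
  - apply Hl, IH.
  - apply Ha; [apply IH |]. induction ts; constructor; [apply IH | assumption].
Qed.

Fixpoint rsize (s : rterm) : nat :=
  match s with
  | rvar _ => 1
  | rlam s => S (rsize s)
  | rapp s ts => S (rsize s + list_sum (map rsize ts))
  end.

(** A name for the anonymous loop inside [lsubst], so that lemmas can speak of it. *)
Fixpoint lsubsts (k : nat) (l acc : list rterm) : list rterm * list rterm :=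
  match l with
  | nil => (nil, acc)
  | u :: l => let (u', a1) := lsubst k u acc in
              let (l', a2) := lsubsts k l a1 in (u' :: l', a2)
  end.

Lemma rocc_app k s ts :
  rocc k (rapp s ts) = rocc k s + list_sum (map (rocc k) ts).
Proof. cbn. f_equal. induction ts as [| t ts IH]; [reflexivity |]. cbn. rewrite IH. reflexivity. Qed.

Lemma rshift_app d c s ts :
  rshift d c (rapp s ts) = rapp (rshift d c s) (map (rshift d c) ts).
Proof. reflexivity. Qed.

Lemma lsubst_app k s us ts :
  lsubst k (rapp s us) ts =
  let (s', ts1) := lsubst k s ts in
  let (us', ts2) := lsubsts k us ts1 in (rapp s' us', ts2).
Proof.
  cbn. destruct (lsubst k s ts) as [s' ts1].
  match goal with |- (let (_, _) := ?go us ts1 in _) = _ =>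
    enough (E : forall l acc, go l acc = lsubsts k l acc) by (rewrite E; reflexivity) end.
  induction l as [| u l IH]; intros acc; [reflexivity |].
  cbn. destruct (lsubst k u acc) as [u' a1]. rewrite IH. reflexivity.
Qed.

(** Comparisons are split from the inside out: one whose left operand still contains a conditional
    waits until that conditional is resolved. *)
Ltac nat_cases :=
  repeat match goal with
  | |- context [?a <? ?b] =>
      lazymatch a with context [if _ then _ else _] => fail | _ => idtac end;
      destruct (Nat.ltb_spec a b)
  end; intros; try lia; try (f_equal; lia); try reflexivity.

Lemma rshift_rshift d k t : forall c c', c' <= c ->
  rshift d (k + c) (rshift k c' t) = rshift k c' (rshift d c t).
Proof.
  induction t as [n | t IH | t ts IHt IHts] using rterm_nested_ind; intros c c' Hc.
  - cbn. nat_cases; cbn; nat_cases.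
  - cbn. f_equal. rewrite plus_n_Sm. apply IH. lia.
  - rewrite !rshift_app. f_equal; [auto |]. rewrite !map_map. apply map_ext_in.
    intros t' Ht'. rewrite Forall_forall in IHts. auto.
Qed.

(** The second cutoff falls inside the gap of [m] indices that the first shift opens at [c], so the
    two shifts together open one gap of [j + m]. *)
Lemma rshift_merge j m i t : forall c, i <= m ->
  rshift j (i + c) (rshift m c t) = rshift (j + m) c t.
Proof.
  induction t as [n | t IH | t ts IHt IHts] using rterm_nested_ind; intros c Hi.
  - cbn. nat_cases; cbn; nat_cases.
  - cbn. f_equal. rewrite plus_n_Sm. auto.
  - rewrite !rshift_app. f_equal; [auto |]. rewrite !map_map. apply map_ext_in.
    intros t' Ht'. rewrite Forall_forall in IHts. auto.
Qed.

Lemma rsize_rshift d t : forall c, rsize (rshift d c t) = rsize t.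
Proof.
  induction t as [n | t IH | t ts IHt IHts] using rterm_nested_ind; intros c.
  - reflexivity.
  - cbn. auto.
  - rewrite rshift_app. cbn. rewrite IHt, map_map. do 3 f_equal.
    apply map_ext_in. intros t' Ht'. rewrite Forall_forall in IHts. auto.
Qed.

(** * Linear substitution as a relation *)

(* [lin_subst k s p c]: [c] is one of the summands of the substitution of the
   bag [p] for index [k] in [s].  The relation is closed under permutations of
   [p], which replaces the sum over the symmetric group. *)
Inductive lin_subst : nat -> rterm -> list rterm -> rterm -> Prop :=
| ls_eq k t : lin_subst k (rvar k) [t] (rshift k 0 t)
| ls_neq k n : n <> k ->
    lin_subst k (rvar n) [] (rvar (if n <? k then n else pred n))
| ls_lam k s p c : lin_subst (S k) s p c -> lin_subst k (rlam s) p (rlam c)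
| ls_app k s ts p p1 p2 c cs :
    lin_subst k s p1 c -> lin_substs k ts p2 cs -> Permutation p (p1 ++ p2) ->
    lin_subst k (rapp s ts) p (rapp c cs)
with lin_substs : nat -> list rterm -> list rterm -> list rterm -> Prop :=
| ls_nil k : lin_substs k [] [] []
| ls_cons k t ts p p1 p2 c cs :
    lin_subst k t p1 c -> lin_substs k ts p2 cs -> Permutation p (p1 ++ p2) ->
    lin_substs k (t :: ts) p (c :: cs).

Scheme lin_subst_mind := Minimality for lin_subst Sort Prop
with lin_substs_mind := Minimality for lin_substs Sort Prop.
Combined Scheme lin_subst_mutind from lin_subst_mind, lin_substs_mind.

Lemma lin_subst_perm k s p c p' :
  lin_subst k s p c -> Permutation p p' -> lin_subst k s p' c.
Proof.
  intros H. revert p'. induction H; intros p' Hp.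
  - apply Permutation_length_1_inv in Hp as ->. constructor.
  - apply Permutation_nil in Hp as ->. constructor; assumption.
  - constructor; auto.
  - econstructor; eauto. rewrite <- Hp. assumption.
Qed.

Lemma lin_substs_perm k s p c p' :
  lin_substs k s p c -> Permutation p p' -> lin_substs k s p' c.
Proof.
  intros H Hp. destruct H.
  - apply Permutation_nil in Hp as ->. constructor; assumption.
  - econstructor; eauto. rewrite <- Hp. assumption.
Qed.

Lemma lin_substs_app k l1 l2 p1 p2 g1 g2 :
  lin_substs k l1 p1 g1 -> lin_substs k l2 p2 g2 ->
  lin_substs k (l1 ++ l2) (p1 ++ p2) (g1 ++ g2).
Proof.
  intros H1 H2. induction H1 as [| k t ts p q1 q2 c cs Ht Hts IH Hp]; cbn; [assumption |].
  econstructor; [eassumption | apply IH; assumption |].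
  rewrite app_assoc. apply Permutation_app_tail. assumption.
Qed.

Lemma lin_substs_app_inv k l1 l2 p g :
  lin_substs k (l1 ++ l2) p g ->
  exists p1 p2 g1 g2, lin_substs k l1 p1 g1 /\ lin_substs k l2 p2 g2 /\
    Permutation p (p1 ++ p2) /\ g = g1 ++ g2.
Proof.
  revert p g. induction l1 as [| t l1 IH]; cbn; intros p g H.
  - exists [], p, [], g. repeat split; auto. constructor.
  - inversion H as [| ? ? ? ? q1 q2 c cs Ht Hts Hp]; subst.
    destruct (IH _ _ Hts) as (p1 & p2 & g1 & g2 & H1 & H2 & Hq & ->).
    exists (q1 ++ p1), p2, (c :: g1), g2. repeat split; auto.
    + econstructor; eauto.
    + rewrite Hp, Hq, app_assoc. reflexivity.
Qed.

Lemma lin_substs_perm_l k l l' p g :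
  Permutation l l' -> lin_substs k l p g ->
  exists g', lin_substs k l' p g' /\ Permutation g g'.
Proof.
  intros Hl. revert p g. induction Hl as [| x l l' Hl IH | x y l | l l' l'' H1 IH1 H2 IH2];
    intros p g H.
  - eauto.
  - inversion H; subst. destruct (IH _ _ ltac:(eassumption)) as (g' & Hg & Hp).
    eexists. split; [econstructor; eauto | auto].
  - inversion H as [| ? ? ? ? p1 p2 c1 cs Hy Hl Hp]; subst.
    inversion Hl as [| ? ? ? ? p3 p4 c2 cs' Hx Hl' Hp']; subst.
    exists (c2 :: c1 :: cs'). split; [| apply perm_swap].
    econstructor; [eassumption | econstructor; [eassumption | eassumption | reflexivity] |].
    rewrite Hp, Hp'. rewrite !app_assoc. apply Permutation_app_tail, Permutation_app_comm.
  - destruct (IH1 _ _ H) as (g1 & Hg1 & P1). destruct (IH2 _ _ Hg1) as (g2 & Hg2 & P2).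
    exists g2. split; [assumption | etransitivity; eassumption].
Qed.

(** The weak inequality is enough to make beta steps decrease the size: the application and the
    abstraction that such a step consumes make it strict. *)
Lemma lin_subst_rsize :
  (forall k s p c, lin_subst k s p c -> rsize c <= rsize s + list_sum (map rsize p)) /\
  (forall k ts p cs, lin_substs k ts p cs ->
     list_sum (map rsize cs) <= list_sum (map rsize ts) + list_sum (map rsize p)).
Proof.
  apply lin_subst_mutind; cbn; intros; try rewrite rsize_rshift; try lia;
  match goal with H : Permutation _ _ |- _ =>
    apply (Permutation_map rsize), Permutation_list_sum in H;
    rewrite map_app, list_sum_app in H end; unfold list_sum in *; lia.
Qed.

Lemma In_insert_all {A : Type} (a : A) l l' :
  In l' (insert_all a l) <-> exists l1 l2, l = l1 ++ l2 /\ l' = l1 ++ a :: l2.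
Proof.
  revert l'. induction l as [| b l IH]; cbn; intros l'; split.
  - intros [<- | []]. exists [], []. auto.
  - intros ([| ? l1] & [| ? l2] & E & ->); try discriminate. auto.
  - intros [<- | H].
    + exists [], (b :: l). auto.
    + apply in_map_iff in H as (l0 & <- & H). apply IH in H as (l1 & l2 & -> & ->).
      exists (b :: l1), l2. auto.
  - intros ([| b' l1] & l2 & E & ->); cbn in E.
    + subst. auto.
    + injection E as -> ->. right. cbn. apply in_map, IH. eauto.
Qed.

Lemma In_perms {A : Type} (l l' : list A) : In l' (perms l) <-> Permutation l l'.
Proof.
  revert l'. induction l as [| a l IH]; cbn; intros l'; split.
  - intros [<- | []]. constructor.
  - intros H. apply Permutation_nil in H as ->. auto.
  - rewrite in_flat_map. intros (x & Hx & H). apply IH in Hx.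
    apply In_insert_all in H as (l1 & l2 & -> & ->). apply Permutation_cons_app. assumption.
  - intros H. destruct (in_split a l') as (l1 & l2 & ->).
    { rewrite <- H. left. reflexivity. }
    apply Permutation_cons_app_inv in H. apply in_flat_map.
    exists (l1 ++ l2). split; [apply IH; assumption |]. apply In_insert_all. eauto.
Qed.

(** The bound on [rocc] keeps [lsubst] away from its default branch for an exhausted list; it then
    takes from the front of [ts] one element per occurrence. *)
Lemma lsubst_lin_subst k s : forall ts, rocc k s <= length ts ->
  exists c p r, ts = p ++ r /\ length p = rocc k s /\
    lsubst k s ts = (c, r) /\ lin_subst k s p c.
Proof.
  revert k. induction s as [n | s IH | s us IHs IHus] using rterm_nested_ind; intros k ts Hts.
  - cbn in *. destruct (Nat.eqb_spec n k) as [-> | Hn].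
    + destruct ts as [| t ts]; cbn in *; [lia |].
      exists (rshift k 0 t), [t], ts. repeat split. constructor.
    + exists (rvar (if n <? k then n else pred n)), [], ts.
      repeat split; [destruct (n <? k); reflexivity | constructor; assumption].
  - cbn in *. destruct (IH (S k) ts Hts) as (c & p & r & -> & Hp & E & H).
    exists (rlam c), p, r. rewrite E. repeat split; auto. constructor; assumption.
  - rewrite rocc_app in *. rewrite lsubst_app.
    destruct (IHs k ts) as (c & p & r & -> & Hp & E & H); [lia |]. rewrite E.
    rewrite length_app in Hts.
    assert (Hus : exists cs p2 r2, r = p2 ++ r2 /\
        length p2 = list_sum (map (rocc k) us) /\
        lsubsts k us r = (cs, r2) /\ lin_substs k us p2 cs).
    { assert (Hr : list_sum (map (rocc k) us) <= length r) by lia. clear - IHus Hr.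
      revert r Hr. induction IHus as [| u us IHu IHus IH]; cbn; intros r Hr.
      - exists [], [], r. repeat split. constructor.
      - destruct (IHu k r) as (c & p & r1 & -> & Hp & E & H); [unfold list_sum in *; lia |].
        rewrite length_app in Hr.
        destruct (IH r1) as (cs & p2 & r2 & -> & Hp2 & E2 & H2); [unfold list_sum in *; lia |].
        exists (c :: cs), (p ++ p2), r2. rewrite E, E2, length_app, app_assoc.
        repeat split; try (unfold list_sum in *; lia). econstructor; eauto. }
    destruct Hus as (cs & p2 & r2 & -> & Hp2 & E2 & H2).
    exists (rapp c cs), (p ++ p2), r2. rewrite E2, length_app, app_assoc.
    repeat split; try (unfold list_sum in *; lia). econstructor; eauto.
Qed.

(** Concatenating the shares of the bag from left to right gives the ordering [p'] that [lsubst]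
    expects. The arbitrary remainder [r] allows the calls on successive subterms to be chained. *)
Lemma lin_subst_lsubst :
  (forall k s p c, lin_subst k s p c ->
     rocc k s = length p /\
     exists p', Permutation p p' /\ forall r, lsubst k s (p' ++ r) = (c, r)) /\
  (forall k ts p cs, lin_substs k ts p cs ->
     list_sum (map (rocc k) ts) = length p /\
     exists p', Permutation p p' /\ forall r, lsubsts k ts (p' ++ r) = (cs, r)).
Proof.
  apply lin_subst_mutind.
  - intros k t. cbn. rewrite Nat.eqb_refl. split; [reflexivity |].
    exists [t]. split; reflexivity.
  - intros k n Hn. cbn. destruct (Nat.eqb_spec n k); [contradiction |].
    split; [reflexivity |]. exists []. split; [reflexivity |].
    intros r. destruct (n <? k); reflexivity.
  - cbn. intros k s p c _ (Ho & p' & Hp & E). split; [assumption |].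
    exists p'. split; [assumption |]. intros r. rewrite E. reflexivity.
  - intros k s ts p p1 p2 c cs _ (Ho1 & q1 & Hq1 & E1) _ (Ho2 & q2 & Hq2 & E2) Hp.
    rewrite rocc_app, (Permutation_length Hp), length_app. split; [lia |].
    exists (q1 ++ q2). split; [rewrite Hp; apply Permutation_app; assumption |].
    intros r. rewrite lsubst_app, <- app_assoc, E1, E2. reflexivity.
  - intros k. split; [reflexivity |]. exists []. split; reflexivity.
  - intros k s ts p p1 p2 c cs _ (Ho1 & q1 & Hq1 & E1) _ (Ho2 & q2 & Hq2 & E2) Hp.
    cbn. rewrite (Permutation_length Hp), length_app. split; [unfold list_sum in *; lia |].
    exists (q1 ++ q2). split; [rewrite Hp; apply Permutation_app; assumption |].
    intros r. rewrite <- app_assoc, E1, E2. reflexivity.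
Qed.

(** The bridge to the relational form. Equality of the number of occurrences with the length of the
    bag means that no element is left over. *)
Lemma In_rsubst0 s ts c : In c (rsubst0 s ts) <-> lin_subst 0 s ts c.
Proof.
  unfold rsubst0. split.
  - destruct (Nat.eqb_spec (rocc 0 s) (length ts)) as [E | E]; [| intros []].
    intros H. apply in_map_iff in H as (p & <- & Hp). apply In_perms in Hp.
    rewrite (Permutation_length Hp) in E.
    destruct (lsubst_lin_subst 0 s p) as (c & q & r & -> & Hq & El & H); [lia |].
    rewrite length_app in E. assert (r = []) as -> by (apply length_zero_iff_nil; lia).
    rewrite app_nil_r in *. rewrite El.
    apply lin_subst_perm with q; [assumption | symmetry; assumption].
  - intros H. apply lin_subst_lsubst in H as (E & p' & Hp & El).
    rewrite E, Nat.eqb_refl. apply in_map_iff. exists p'.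
    specialize (El []). rewrite app_nil_r in El. rewrite El.
    split; [reflexivity |]. apply In_perms. assumption.
Qed.

(** The cutoffs differ because the scopes do: [p] lives outside the [j] binders crossed so far, [c]
    lives under them, and [s] has in addition the index that is substituted away. *)
Lemma lin_subst_rshift d :
  (forall j s p c, lin_subst j s p c -> forall i,
     lin_subst j (rshift d (S (j + i)) s) (map (rshift d i) p) (rshift d (j + i) c)) /\
  (forall j ts p cs, lin_substs j ts p cs -> forall i,
     lin_substs j (map (rshift d (S (j + i))) ts) (map (rshift d i) p)
       (map (rshift d (j + i)) cs)).
Proof.
  apply lin_subst_mutind.
  - intros k t i. rewrite rshift_rshift by lia. cbn [rshift map].
    destruct (Nat.ltb_spec k (S (k + i))); [constructor | lia].
  - intros k n Hn i. cbn [rshift map].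
    (* The resulting index is left open: [ls_neq] fixes it to the expression it produces, and case
       analysis then identifies it with the shifted one. *)
    evar (x : nat).
    replace (rvar (if (if n <? k then n else pred n) <? k + i
              then if n <? k then n else pred n
              else (if n <? k then n else pred n) + d))
      with (rvar x); subst x.
    { apply ls_neq. nat_cases. }
    nat_cases.
  - intros k s p c _ IH i. cbn. constructor. apply (IH i).
  - intros k s ts p p1 p2 c cs _ IH1 _ IH2 Hp i. rewrite !rshift_app.
    econstructor; [apply IH1 | apply IH2 |]. rewrite <- map_app. apply Permutation_map.
    assumption.
  - intros. constructor.
  - intros k s ts p p1 p2 c cs _ IH1 _ IH2 Hp i. cbn.
    econstructor; [apply IH1 | apply IH2 |]. rewrite <- map_app. apply Permutation_map.
    assumption.
Qed.

(** The substituted index lies above the gap of [j] indices opened at [i], so the substitution can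
    be done before the shift, at an index lower by [j]. This serves for substituting into a copy
    that was itself inserted by a substitution. *)
Lemma lin_subst_rshift_inv j t : forall i k p c,
  lin_subst (j + (i + k)) (rshift j i t) p c ->
  exists c0, c = rshift j i c0 /\ lin_subst (i + k) t p c0.
Proof.
  induction t as [n | t IH | t ts IHt IHts] using rterm_nested_ind; intros i k p c H.
  - cbn in H. inversion H as [k' t E1 E2 | k' n' Hn E1 E2 | |]; subst.
    + destruct (Nat.ltb_spec n i); [lia |].
      assert (n = i + k) as -> by lia. exists (rshift (i + k) 0 t). split; [| constructor].
      assert (E := rshift_merge j (i + k) i t 0).
      rewrite Nat.add_0_r in E. rewrite E by lia. reflexivity.
    + exists (rvar (if n <? i + k then n else pred n)). split.
      * cbn. revert Hn. nat_cases.
      * constructor. revert Hn. nat_cases.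
  - cbn in H. inversion H as [| | ? ? ? c' H' |]; subst.
    replace (S (j + (i + k))) with (j + (S i + k)) in H' by lia.
    apply IH in H' as (c0 & -> & H'). exists (rlam c0). split; [reflexivity |].
    constructor. assumption.
  - rewrite rshift_app in H. inversion H as [| | | ? ? ? ? p1 p2 c' cs H1 H2 Hp]; subst.
    apply IHt in H1 as (c0 & -> & H1).
    assert (exists cs0, cs = map (rshift j i) cs0 /\ lin_substs (i + k) ts p2 cs0)
      as (cs0 & -> & H2').
    { clear - IHts H2. revert p2 cs H2. induction IHts as [| t ts IHt IHts IH];
        cbn; intros p cs H.
      - inversion H; subst. exists []. split; [reflexivity | constructor].
      - inversion H as [| ? ? ? ? p1 p2 c' cs' H1 H2 Hp]; subst.
        apply IHt in H1 as (c0 & -> & H1). apply IH in H2 as (cs0 & -> & H2).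
        exists (c0 :: cs0). split; [reflexivity | econstructor; eauto]. }
    exists (rapp c0 cs0). split; [reflexivity | econstructor; eauto].
Qed.

(** The index [i + j] lies in the gap opened by the shift, hence does not occur; substituting the
    empty bag for it narrows the gap by one. *)
Lemma lin_subst_rshift_nil j d t : forall i, j <= d ->
  lin_subst (i + j) (rshift (S d) i t) [] (rshift d i t).
Proof.
  induction t as [n | t IH | t ts IHt IHts] using rterm_nested_ind; intros i Hj.
  - cbn.
    replace (if n <? i then n else n + d)
      with (if (if n <? i then n else n + S d) <? i + j
            then if n <? i then n else n + S d
            else pred (if n <? i then n else n + S d)) by nat_cases.
    constructor. nat_cases.
  - cbn. constructor. apply (IH (S i)). assumption.
  - rewrite !rshift_app. apply ls_app with (p1 := []) (p2 := []); auto.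
    induction IHts as [| t' ts IHt' IHts IH]; cbn; [constructor |].
    apply ls_cons with (p1 := []) (p2 := []); auto.
Qed.

Lemma perm_app_exchange {A : Type} (p p1 p2 a b c d : list A) :
  Permutation p (p1 ++ p2) -> Permutation p1 (a ++ b) -> Permutation p2 (c ++ d) ->
  Permutation p ((a ++ c) ++ (b ++ d)).
Proof.
  intros -> -> ->. rewrite <- !app_assoc. apply Permutation_app_head.
  rewrite !app_assoc. apply Permutation_app_tail, Permutation_app_comm.
Qed.

(* The substitution lemma, read from the result of the two nested substitutions. *)
Lemma lin_subst_lin_subst_exchange :
  (forall j e f a, lin_subst j e f a -> forall k p c, lin_subst (j + k) a p c ->
     exists p1 p2 e' g, Permutation p (p1 ++ p2) /\
       lin_subst (S (j + k)) e p1 e' /\ lin_substs k f p2 g /\ lin_subst j e' g c) /\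
  (forall j es f l, lin_substs j es f l -> forall k p cs, lin_substs (j + k) l p cs ->
     exists p1 p2 es' g, Permutation p (p1 ++ p2) /\
       lin_substs (S (j + k)) es p1 es' /\ lin_substs k f p2 g /\ lin_substs j es' g cs).
Proof.
  apply lin_subst_mutind.
  - intros j t k p c H. apply (lin_subst_rshift_inv j t 0 k) in H as (c0 & -> & H).
    (* All of [p] goes into the inserted copy of [t], and none into the variable that it
       replaces. *)
    exists [], p, (rvar j), [c0]. repeat split.
    + reflexivity.
    + evar (x : nat). replace j with x at 3; subst x; [apply ls_neq; lia |]. nat_cases.
    + econstructor; [eassumption | constructor | rewrite app_nil_r; reflexivity].
    + constructor.
  - intros j n Hn k p c H.
    inversion H as [k' t E1 E2 | k' n' Hn' E1 E2 | |]; subst.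
    + assert (n = S (j + k)) as ->.
      { revert Hn E2. destruct (Nat.ltb_spec n j); lia. }
      (* Here [n] is the outer index as seen before the inner substitution. The inner bag is empty,
         so substituting it only lowers the indices of the inserted [t]. *)
      exists [t], [], (rshift (S (j + k)) 0 t), []. repeat split; try constructor; auto.
      apply (lin_subst_rshift_nil j (j + k) t 0). lia.
    + exists [], [], (rvar (if n <? S (j + k) then n else pred n)), [].
      repeat split; try constructor.
      * revert Hn Hn'. nat_cases.
      * evar (x : nat).
        replace (rvar (if (if n <? j then n else pred n) <? j + k
              then if n <? j then n else pred n
              else pred (if n <? j then n else pred n)))
          with (rvar x); subst x.
        { apply ls_neq. revert Hn Hn'. nat_cases. }
        revert Hn Hn'. nat_cases.
  - intros j s f a _ IH k p c H. inversion H as [| | ? ? ? c' H' |]; subst.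
    destruct (IH k _ _ H') as (p1 & p2 & e' & g & Hp & H1 & H2 & H3).
    exists p1, p2, (rlam e'), g. repeat split; auto; constructor; assumption.
  - intros j s ts f f1 f2 a l _ IH1 _ IH2 Hf k p c H.
    inversion H as [| | | ? ? ? ? q1 q2 c' cs H1 H2 Hp]; subst.
    destruct (IH1 k _ _ H1) as (p1 & p2 & e' & g & Hp1 & A1 & A2 & A3).
    destruct (IH2 k _ _ H2) as (p3 & p4 & es' & g' & Hp2 & B1 & B2 & B3).
    (* The bag [f] was split only up to permutation, so its substituted members are reordered to
       match. *)
    destruct (lin_substs_perm_l k (f1 ++ f2) f (p2 ++ p4) (g ++ g')) as (g'' & G1 & G2).
    { symmetry. assumption. }
    { apply lin_substs_app; assumption. }
    exists (p1 ++ p3), (p2 ++ p4), (rapp e' es'), g''. repeat split.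
    + eapply perm_app_exchange; eassumption.
    + econstructor; [eassumption | eassumption | reflexivity].
    + assumption.
    + econstructor; [eassumption | eassumption | symmetry; assumption].
  - intros j k p cs H. inversion H; subst. exists [], [], [], []. repeat split; constructor.
  - intros j s ts f f1 f2 a l _ IH1 _ IH2 Hf k p c H.
    inversion H as [| ? ? ? ? q1 q2 c' cs H1 H2 Hp]; subst.
    destruct (IH1 k _ _ H1) as (p1 & p2 & e' & g & Hp1 & A1 & A2 & A3).
    destruct (IH2 k _ _ H2) as (p3 & p4 & es' & g' & Hp2 & B1 & B2 & B3).
    destruct (lin_substs_perm_l k (f1 ++ f2) f (p2 ++ p4) (g ++ g')) as (g'' & G1 & G2).
    { symmetry. assumption. }
    { apply lin_substs_app; assumption. }
    exists (p1 ++ p3), (p2 ++ p4), (e' :: es'), g''. repeat split.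
    + eapply perm_app_exchange; eassumption.
    + econstructor; [eassumption | eassumption | reflexivity].
    + assumption.
    + econstructor; [eassumption | eassumption | symmetry; assumption].
Qed.

(** * Reduction to a single summand *)

(** A redex whose reduct is the empty sum gives no step here, so every path follows a summand that
    survives. *)
Inductive rto : rterm -> rterm -> Prop :=
| rto_beta s ts c : lin_subst 0 s ts c -> rto (rapp (rlam s) ts) c
| rto_lam s t : rto s t -> rto (rlam s) (rlam t)
| rto_appl s t ts : rto s t -> rto (rapp s ts) (rapp t ts)
| rto_bag s ts1 t t' ts2 : rto t t' ->
    rto (rapp s (ts1 ++ t :: ts2)) (rapp s (ts1 ++ t' :: ts2)).

Notation rtos := (clos_refl_trans rterm rto).

Lemma rto_of_rstep s T t : rstep s T -> In t T -> rto s t.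
Proof.
  intros H. revert t. induction H; intros u Hu.
  - constructor. apply In_rsubst0. assumption.
  - apply in_map_iff in Hu as (? & <- & ?). constructor. auto.
  - apply in_map_iff in Hu as (? & <- & ?). constructor. auto.
  - apply in_map_iff in Hu as (? & <- & ?). constructor. auto.
Qed.

Lemma rstep_of_rto s t : rto s t -> exists T, rstep s T /\ In t T.
Proof.
  induction 1 as [s ts c H | s t _ (T & H & HT) | s t ts _ (T & H & HT)
    | s ts1 t t' ts2 _ (T & H & HT)].
  - exists (rsubst0 s ts). split; [constructor | apply In_rsubst0; assumption].
  - exists (map rlam T). split; [constructor; assumption | apply in_map; assumption].
  - eexists. split; [constructor; eassumption |].
    apply in_map_iff. eauto.
  - eexists. split; [constructor; eassumption |].
    apply in_map_iff. eauto.
Qed.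

Lemma rto_rsize s t : rto s t -> rsize t < rsize s.
Proof.
  induction 1 as [s ts c H | | | s ts1 t t' ts2 _ IH]; cbn; try lia.
  - apply lin_subst_rsize in H. lia.
  - rewrite !map_app, !list_sum_app. cbn. lia.
Qed.

Lemma rtos_lam s t : rtos s t -> rtos (rlam s) (rlam t).
Proof.
  induction 1 as [s t H | | s t u _ IH1 _ IH2]; [| apply rt_refl | eapply rt_trans; eassumption].
  apply rt_step. constructor. assumption.
Qed.

Lemma rtos_appl s t ts : rtos s t -> rtos (rapp s ts) (rapp t ts).
Proof.
  induction 1 as [s t H | | s t u _ IH1 _ IH2]; [| apply rt_refl | eapply rt_trans; eassumption].
  apply rt_step. constructor. assumption.
Qed.

Lemma rtos_bag s ts ts' : Forall2 rtos ts ts' -> rtos (rapp s ts) (rapp s ts').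
Proof.
  (* The members already reduced accumulate in a prefix, which is generalised for the induction. *)
  intros H. change (rtos (rapp s ([] ++ ts)) (rapp s ([] ++ ts'))).
  generalize (@nil rterm) as l. induction H as [| t t' ts ts' Ht Hts IH]; intros l.
  - apply rt_refl.
  - apply rt_trans with (rapp s (l ++ t' :: ts)).
    + clear - Ht. induction Ht; [apply rt_step; constructor; assumption | apply rt_refl |
        eapply rt_trans; eassumption].
    + specialize (IH (l ++ [t'])). rewrite <- !app_assoc in IH. exact IH.
Qed.

Lemma rto_rshift d s t : rto s t -> forall c, rto (rshift d c s) (rshift d c t).
Proof.
  induction 1 as [s ts c H | s t _ IH | s t ts _ IH | s ts1 t t' ts2 _ IH]; intros i.
  - rewrite rshift_app. cbn. constructor. apply (lin_subst_rshift d) with (j := 0). assumption.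
  - cbn. constructor. apply IH.
  - rewrite !rshift_app. constructor. apply IH.
  - rewrite !rshift_app, !map_app. cbn [map]. constructor. apply IH.
Qed.

Lemma perm_cons_app_inv {A : Type} (a : A) q p1 p2 :
  Permutation (a :: q) (p1 ++ p2) ->
  (exists q1, Permutation p1 (a :: q1) /\ Permutation q (q1 ++ p2)) \/
  (exists q2, Permutation p2 (a :: q2) /\ Permutation q (p1 ++ q2)).
Proof.
  intros H. assert (Ha : In a (p1 ++ p2)) by (rewrite <- H; left; reflexivity).
  apply in_app_or in Ha as [Ha | Ha]; apply in_split in Ha as (l1 & l2 & ->).
  - left. exists (l1 ++ l2). split; [symmetry; apply Permutation_middle |].
    rewrite <- !app_assoc in *. apply Permutation_cons_app_inv with a. exact H.
  - right. exists (l1 ++ l2). split; [symmetry; apply Permutation_middle |].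
    rewrite app_assoc in *. apply Permutation_cons_app_inv with a. exact H.
Qed.

(** By linearity [t'] is inserted exactly once, so putting [t] in its place leaves a single step to
    perform after the substitution. *)
Lemma lin_subst_rto_r t t' : rto t t' ->
  (forall k s p c, lin_subst k s p c -> forall q, Permutation p (t' :: q) ->
     exists d, lin_subst k s (t :: q) d /\ rto d c) /\
  (forall k ts p cs, lin_substs k ts p cs -> forall q, Permutation p (t' :: q) ->
     exists l1 x x' l2, cs = l1 ++ x' :: l2 /\ rto x x' /\
       lin_substs k ts (t :: q) (l1 ++ x :: l2)).
Proof.
  intros Ht. apply lin_subst_mutind.
  - intros k u q Hp. apply Permutation_length_1_inv in Hp.
    injection Hp as -> ->. exists (rshift k 0 t). split; [constructor |].
    apply rto_rshift. assumption.
  - intros k n _ q' Hp. apply Permutation_nil in Hp. discriminate.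
  - intros k s p c _ IH q' Hp. destruct (IH q' Hp) as (d & Hd & Hdc).
    exists (rlam d). split; constructor; assumption.
  - intros k s ts p p1 p2 c cs H1 IH1 H2 IH2 Hp q' Hq.
    rewrite Hq in Hp. apply perm_cons_app_inv in Hp as [(q1 & E1 & E2) | (q1 & E1 & E2)].
    + destruct (IH1 _ E1) as (d & Hd & Hdc). exists (rapp d cs). split; [| constructor; assumption].
      econstructor; [eassumption | eassumption | cbn; constructor; assumption].
    + destruct (IH2 _ E1) as (l1 & x & x' & l2 & -> & Hx & Hl).
      exists (rapp c (l1 ++ x :: l2)). split; [| constructor; assumption].
      econstructor; [eassumption | eassumption | apply Permutation_cons_app; assumption].
  - intros k q' Hp. apply Permutation_nil in Hp. discriminate.
  - intros k s ts p p1 p2 c cs H1 IH1 H2 IH2 Hp q' Hq.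
    rewrite Hq in Hp. apply perm_cons_app_inv in Hp as [(q1 & E1 & E2) | (q1 & E1 & E2)].
    + destruct (IH1 _ E1) as (d & Hd & Hdc). exists [], d, c, cs.
      repeat split; [assumption |].
      econstructor; [eassumption | eassumption | cbn; constructor; assumption].
    + destruct (IH2 _ E1) as (l1 & x & x' & l2 & -> & Hx & Hl).
      exists (c :: l1), x, x', l2. repeat split; [assumption |].
      econstructor; [eassumption | eassumption | apply Permutation_cons_app; assumption].
Qed.

(** The step on [a] is postponed past the substitution. Steps in context follow by induction; a beta
    step is the exchange of two linear substitutions. *)
Lemma lin_subst_rto_l a a' : rto a a' -> forall k p c, lin_subst k a' p c ->
  exists d, lin_subst k a p d /\ rto d c.
Proof.
  induction 1 as [s ts a' H | s t _ IH | s t ts _ IH | s ts1 t t' ts2 _ IH]; intros k p c Hc.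
  - destruct (proj1 lin_subst_lin_subst_exchange 0 s ts a' H k p c Hc)
      as (p1 & p2 & e' & g & Hp & H1 & H2 & H3).
    exists (rapp (rlam e') g). split; [| constructor; assumption].
    econstructor; [constructor; eassumption | eassumption | assumption].
  - inversion Hc as [| | ? ? ? c' H' |]; subst. apply IH in H' as (d & Hd & Hdc).
    exists (rlam d). split; constructor; assumption.
  - inversion Hc as [| | | ? ? ? ? p1 p2 c' cs H1 H2 Hp]; subst.
    apply IH in H1 as (d & Hd & Hdc).
    exists (rapp d cs). split; [econstructor; eassumption | constructor; assumption].
  - inversion Hc as [| | | ? ? ? ? p1 p2 c' cs H1 H2 Hp]; subst.
    apply lin_substs_app_inv in H2 as (q1 & q2 & g1 & g2 & A1 & A2 & A3 & ->).
    inversion A2 as [| ? ? ? ? r1 r2 b bs B1 B2 B3]; subst.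
    apply IH in B1 as (d & Hd & Hdb).
    exists (rapp c' (g1 ++ d :: bs)). split; [| constructor; assumption].
    econstructor; [eassumption | | eassumption].
    eapply lin_substs_perm; [| symmetry; eassumption].
    apply lin_substs_app; [assumption |]. econstructor; eassumption.
Qed.

Lemma rto_lam_inv s t : rto (rlam s) t -> exists t', t = rlam t' /\ rto s t'.
Proof. intros H. inversion H; subst. eauto. Qed.

(** * Head reduction of resource terms *)

Inductive rhto : rterm -> rterm -> Prop :=
| rhto_beta s ts c : lin_subst 0 s ts c -> rhto (rapp (rlam s) ts) c
| rhto_lam s t : rhto s t -> rhto (rlam s) (rlam t)
| rhto_app s t ts : (forall u, s <> rlam u) -> rhto s t -> rhto (rapp s ts) (rapp t ts).

Inductive rhead_var : rterm -> Prop :=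
| rhv_var n : rhead_var (rvar n)
| rhv_app s ts : rhead_var s -> rhead_var (rapp s ts).

Inductive rhnf : rterm -> Prop :=
| rhnf_lam s : rhnf s -> rhnf (rlam s)
| rhnf_hv s : rhead_var s -> rhnf s.

Lemma rhto_rto s t : rhto s t -> rto s t.
Proof. induction 1; constructor; assumption. Qed.

Lemma rhnf_app_inv s ts : rhnf (rapp s ts) -> rhead_var s.
Proof. intros H. inversion H as [| ? H']; subst. inversion H'; subst. assumption. Qed.

Lemma rhnf_lam_inv s : rhnf (rlam s) -> rhnf s.
Proof. intros H. inversion H as [| ? H']; subst; [assumption | inversion H']. Qed.

Lemma not_rhead_var_lam s : ~ rhead_var (rlam s).
Proof. intros H. inversion H. Qed.

Lemma rlam_dec s : (exists u, s = rlam u) \/ (forall u, s <> rlam u).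
Proof. destruct s; eauto; right; discriminate. Qed.

Lemma rhnf_of_normal s : (forall T, ~ rstep s T) -> rhnf s.
Proof.
  induction s as [n | s IH | s ts IH _] using rterm_nested_ind; intros H.
  - repeat constructor.
  - constructor. apply IH. intros T HT. apply (H (map rlam T)). constructor. assumption.
  - assert (Hs : rhnf s).
    { apply IH. intros T HT. apply (H (map (fun s' => rapp s' ts) T)).
      constructor. assumption. }
    destruct Hs as [s Hs | s Hs].
    (* An abstraction in function position is a redex, even when its reduct is the empty sum. *)
    + destruct (H (rsubst0 s ts)). constructor.
    + do 2 constructor. assumption.
Qed.

(** A step other than the head step does not affect the head position. The claim on [rhead_var] is
    carried along because it is what the function part of an application has to provide. *)
Lemma rto_reflects_rhnf s t : rto s t ->
  rhto s t \/ ((rhnf t -> rhnf s) /\ (rhead_var t -> rhead_var s)).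
Proof.
  induction 1 as [s ts c H | s t _ IH | s t ts H IH | s ts1 t t' ts2 _ _].
  - left. constructor. assumption.
  - destruct IH as [IH | [IH _]]; [left; constructor; assumption |]. right. split.
    + intros Ht. constructor. apply IH, rhnf_lam_inv, Ht.
    + intros Ht. destruct (not_rhead_var_lam _ Ht).
  - destruct (rlam_dec s) as [[u ->] | Hs].
    (* The step takes place below the abstraction of the head redex, which survives it; both
       implications are therefore vacuous. *)
    + apply rto_lam_inv in H as (t' & -> & _). right. split; intros Ht.
      * destruct (not_rhead_var_lam _ (rhnf_app_inv _ _ Ht)).
      * inversion Ht; subst. destruct (not_rhead_var_lam t'). assumption.
    + destruct IH as [IH | [_ IH]]; [left; constructor; assumption |]. right. split; intros Ht.
      * do 2 constructor. apply IH, (rhnf_app_inv _ _ Ht).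
      * inversion Ht; subst. constructor. auto.
  - right. split; intros Ht.
    + do 2 constructor. apply (rhnf_app_inv _ _ Ht).
    + inversion Ht; subst. constructor. assumption.
Qed.

(** If the first step is itself the head step, nothing has to be moved. Otherwise the head redex is
    already present in [s], and linearity allows a step taken in its body or in its bag to be
    postponed. *)
Lemma rto_rhto_swap s t c : rto s t -> rhto t c ->
  exists t', rhto s t' /\ rtos t' c.
Proof.
  intros H. revert c.
  induction H as [s ts t H | s t _ IH | s t ts H IH | s ts1 t t' ts2 H _]; intros c Hc.
  - exists t. split; [constructor; assumption | apply rt_step, rhto_rto; assumption].
  - inversion Hc as [| ? c' Hc' |]; subst. apply IH in Hc' as (t' & H1 & H2).
    exists (rlam t'). split; [constructor; assumption | apply rtos_lam; assumption].
  - destruct (rlam_dec s) as [[u ->] | Hs].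
    + apply rto_lam_inv in H as (t' & -> & H).
      inversion Hc as [? ? ? Hc' | | ? ? ? Ht]; subst; [| destruct (Ht t'); reflexivity].
      destruct (lin_subst_rto_l _ _ H _ _ _ Hc') as (d & H1 & H2).
      exists d. split; [constructor; assumption | apply rt_step; assumption].
    + destruct (rlam_dec t) as [[u ->] | Ht].
      (* Since [s] is not an abstraction, only a beta step at its root can produce one, and that
         step is the head step. *)
      * exists (rapp (rlam u) ts). split; [constructor; [assumption |] |
          apply rt_step, rhto_rto; assumption].
        inversion H; subst; [constructor; assumption | destruct (Hs s0); reflexivity].
      * inversion Hc as [| | ? c' ? _ Hc']; subst; [destruct (Ht s0); reflexivity |].
        apply IH in Hc' as (t' & H1 & H2). exists (rapp t' ts).
        split; [constructor; assumption | apply rtos_appl; assumption].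
  - inversion Hc as [s0 ? ? Hc' | | ? c' ? Hs Hc']; subst.
    + destruct (proj1 (lin_subst_rto_r _ _ H) _ _ _ _ Hc' (ts1 ++ ts2)) as (d & H1 & H2).
      { symmetry. apply Permutation_middle. }
      exists d. split; [| apply rt_step; assumption].
      constructor. eapply lin_subst_perm; [eassumption | apply Permutation_middle].
    + exists (rapp c' (ts1 ++ t :: ts2)).
      split; [constructor; assumption | apply rt_step; constructor; assumption].
Qed.

(** A head step met later on the path is moved to the front by successive swaps; if there is none,
    head normality of [u] is reflected back to [s]. *)
Lemma rtos_rhnf_head_first s u : rtos s u -> rhnf u ->
  rhnf s \/ exists t, rhto s t /\ rtos t u.
Proof.
  intros H Hu. apply clos_rt_rt1n in H.
  induction H as [| s t u Hst Htu IH]; [left; assumption |].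
  apply clos_rt1n_rt in Htu.
  destruct (rto_reflects_rhnf _ _ Hst) as [Hh | [Hr _]]; [right; eauto |].
  destruct (IH Hu) as [Ht | (t' & H1 & H2)]; [left; auto |].
  destruct (rto_rhto_swap _ _ _ Hst H1) as (t'' & H3 & H4).
  right. exists t''. split; [assumption | eapply rt_trans; eassumption].
Qed.

(** * Reduction of sums *)

Lemma sreds_keep S : sreds false S S.
Proof. induction S; constructor; assumption. Qed.

Lemma sreds_app b1 b2 S1 S1' S2 S2' :
  sreds b1 S1 S1' -> sreds b2 S2 S2' -> sreds (b1 || b2) (S1 ++ S2) (S1' ++ S2').
Proof.
  intros H1 H2. induction H1; cbn; [assumption | constructor; assumption |].
  rewrite <- app_assoc. econstructor; eassumption.
Qed.

Lemma sred_star_trans S1 S2 S3 : sred_star S1 S2 -> sred_star S2 S3 -> sred_star S1 S3.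
Proof. induction 1; intros; [assumption | econstructor; eauto]. Qed.

Lemma sred_star_app S1 S1' S2 S2' :
  sred_star S1 S1' -> sred_star S2 S2' -> sred_star (S1 ++ S2) (S1' ++ S2').
Proof.
  intros H1 H2. apply sred_star_trans with (S1' ++ S2).
  - clear H2. induction H1 as [| S S' S'' H _ IH]; [constructor |].
    econstructor; [| exact IH]. apply (sreds_app true false); [assumption | apply sreds_keep].
  - clear H1. induction H2 as [| S S' S'' H _ IH]; [constructor |].
    econstructor; [| exact IH]. apply (sreds_app false true); [apply sreds_keep | assumption].
Qed.

Lemma sred_star_rtos S S' u : sred_star S S' -> In u S' -> exists s, In s S /\ rtos s u.
Proof.
  induction 1 as [S | S S' S'' H _ IH]; intros Hu; [exists u; split; [assumption | apply rt_refl] |].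
  destruct (IH Hu) as (t & Ht & Htu). unfold sstep in H. clear IH Hu. revert H Ht.
  (* The flag is generalised because the tail of a reducing sum may contain no reducing summand. *)
  generalize true. intros b H Ht.
  enough (exists s, In s S /\ rtos s t) as (s & Hs & Hst)
    by (exists s; split; [assumption | eapply rt_trans; eassumption]).
  induction H as [| b s S S' _ IH | b s T S S' H _ IH].
  - destruct Ht.
  - destruct Ht as [<- | Ht]; [exists s; split; [left; reflexivity | apply rt_refl] |].
    destruct (IH Ht) as (s' & ? & ?). exists s'. split; [right|]; assumption.
  - apply in_app_or in Ht as [Ht | Ht].
    + exists s. split; [left; reflexivity | apply rt_step]. eapply rto_of_rstep; eassumption.
    + destruct (IH Ht) as (s' & ? & ?). exists s'. split; [right|]; assumption.
Qed.

Lemma sred_star_rstep s T S : rstep s T -> sred_star T S -> sred_star [s] S.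
Proof.
  intros H. apply ss_step. unfold sstep. rewrite <- (app_nil_r T).
  econstructor; [eassumption | constructor].
Qed.

Lemma sum_normalising T : (forall t, In t T -> exists S, nf_r t S) ->
  exists S, sred_star T S /\ sum_normal S.
Proof.
  induction T as [| t T IH]; intros H.
  - exists []. split; [constructor | intros ? []].
  - destruct (H t) as (S1 & R1 & N1); [left; reflexivity |].
    destruct IH as (S2 & R2 & N2); [intros; apply H; right; assumption |].
    exists (S1 ++ S2). split; [apply (sred_star_app [t] S1 T S2); assumption |].
    intros u Hu. apply in_app_or in Hu as [Hu | Hu]; auto.
Qed.

Lemma rstep_dec s : (exists T, rstep s T) \/ (forall T, ~ rstep s T).
Proof.
  induction s as [n | s IH | s ts IH IHts] using rterm_nested_ind.
  - right. intros T H. inversion H.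
  - destruct IH as [[T H] | IH]; [left; eexists; constructor; eassumption |].
    right. intros T H. inversion H; subst. eapply IH. eassumption.
  - destruct (rlam_dec s) as [[u ->] | Hs]; [left; eexists; constructor |].
    destruct IH as [[T H] | IH]; [left; eexists; constructor; eassumption |].
    assert (Hts : (exists ts1 t ts2 T, ts = ts1 ++ t :: ts2 /\ rstep t T) \/
        (forall t, In t ts -> forall T, ~ rstep t T)).
    { clear - IHts. induction IHts as [| t ts [[T H] | Ht] _ IH].
      - right. intros ? [].
      - left. exists [], t, ts, T. auto.
      - destruct IH as [(ts1 & t' & ts2 & T & -> & H) | IH].
        + left. exists (t :: ts1), t', ts2, T. auto.
        + right. intros t' [<- | Ht']; auto. }
    destruct Hts as [(ts1 & t & ts2 & T & -> & H) | Hts].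
    + left. eexists. apply rs_bag. eassumption.
    + right. intros T H. inversion H; subst.
      * eapply Hs. reflexivity.
      * eapply IH. eassumption.
      * eapply Hts; [| eassumption]. apply in_elt.
Qed.

(** Induction on the size: every summand of a reduct is strictly smaller. *)
Lemma nf_r_exists s : exists S, nf_r s S.
Proof.
  induction s as [s IH] using (well_founded_induction (well_founded_ltof _ rsize)).
  destruct (rstep_dec s) as [[T H] | H].
  - destruct (sum_normalising T) as (S & R & N).
    { intros t Ht. apply IH, rto_rsize. eapply rto_of_rstep; eassumption. }
    exists S. split; [| assumption]. eapply sred_star_rstep; eassumption.
  - exists [s]. split; [constructor |]. intros t [<- | []]. assumption.
Qed.

(** The normal form is built along the given path. The summand on the path contributes a nonempty
    part by induction, and the others, normalised separately, cancel nothing. *)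
Lemma nf_r_nonempty_of_rtos s u : rtos s u -> (forall T, ~ rstep u T) ->
  exists S, nf_r s S /\ S <> nil.
Proof.
  intros H Hu. apply clos_rt_rt1n in H. induction H as [u | s t u Hst _ IH].
  - exists [u]. split; [| discriminate]. split; [constructor |].
    intros t [<- | []]. assumption.
  - destruct (IH Hu) as (S & (R & N) & HS). apply rstep_of_rto in Hst as (T & H & Ht).
    apply in_split in Ht as (T1 & T2 & ->).
    destruct (sum_normalising T1) as (S1 & R1 & N1); [intros; apply nf_r_exists |].
    destruct (sum_normalising T2) as (S2 & R2 & N2); [intros; apply nf_r_exists |].
    exists (S1 ++ S ++ S2). split; [split |].
    + eapply sred_star_rstep; [eassumption |].
      apply sred_star_app; [assumption | apply (sred_star_app [t] S T2 S2); assumption].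
    + intros v Hv. apply in_app_or in Hv as [Hv | Hv]; [auto |].
      apply in_app_or in Hv as [Hv | Hv]; auto.
    + intros E. apply app_eq_nil in E as [_ E]. apply app_eq_nil in E as [E _]. auto.
Qed.

(** * Infinitary terms *)

(** Matching on a term forces a cofixpoint to unfold once, which makes the rewriting equations below
    hold by computation. *)
Definition unfold_term (M : term) : term :=
  match M with var n => var n | lam P => lam P | app P Q => app P Q end.

Lemma unfold_termE M : M = unfold_term M.
Proof. destruct M; reflexivity. Qed.

Lemma shift_var d c n : shift d c (var n) = var (if n <? c then n else n + d).
Proof. rewrite (unfold_termE (shift _ _ _)). reflexivity. Qed.

Lemma shift_lam d c P : shift d c (lam P) = lam (shift d (S c) P).
Proof. rewrite (unfold_termE (shift _ _ _)). reflexivity. Qed.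

Lemma shift_tapp d c P Q : shift d c (app P Q) = app (shift d c P) (shift d c Q).
Proof. rewrite (unfold_termE (shift _ _ _)). reflexivity. Qed.

Lemma subst_var k N n : subst k N (var n) =
  if n =? k then shift k 0 N else if n <? k then var n else var (pred n).
Proof.
  rewrite (unfold_termE (subst _ _ _)), (unfold_termE (if n =? k then _ else _)). reflexivity.
Qed.

Lemma subst_lam k N P : subst k N (lam P) = lam (subst (S k) N P).
Proof. rewrite (unfold_termE (subst _ _ _)). reflexivity. Qed.

Lemma subst_app k N P Q : subst k N (app P Q) = app (subst k N P) (subst k N Q).
Proof. rewrite (unfold_termE (subst _ _ _)). reflexivity. Qed.

Lemma spine001_mono (P Q : term -> Prop) M :
  (forall N, P N -> Q N) -> spine001 P M -> spine001 Q M.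
Proof. intros HPQ H. induction H; constructor; auto. Qed.

(** [Lam001] is the union of the post-fixed points of the monotone operator [spine001], hence its
    greatest fixed point. *)
Lemma Lam001_spine M : Lam001 M <-> spine001 Lam001 M.
Proof.
  assert (A : forall M, Lam001 M -> spine001 Lam001 M).
  { intros N (P & HN & HP). apply spine001_mono with P; [| auto]. intros N' HN'. exists P. auto. }
  split; [apply A |]. intros H. exists (spine001 Lam001). split; [assumption |].
  intros N. apply spine001_mono. assumption.
Qed.

Lemma Lam001_shift d c M : Lam001 M -> Lam001 (shift d c M).
Proof.
  intros H. exists (fun N => exists c M, N = shift d c M /\ Lam001 M). split; [eauto |].
  clear. intros N (c & M & -> & H). apply Lam001_spine in H. revert c.
  induction H as [n | M _ IH | M N _ IH HN]; intros c.
  - rewrite shift_var. constructor.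
  - rewrite shift_lam. constructor. auto.
  - rewrite shift_tapp. constructor; eauto.
Qed.

Lemma Lam001_subst k N M : Lam001 N -> Lam001 M -> Lam001 (subst k N M).
Proof.
  intros HN HM.
  (* The first disjunct covers the copies of [N] put in place of variables, which need not be
     substitution instances. *)
  exists (fun X => Lam001 X \/ exists k M, X = subst k N M /\ Lam001 M).
  split; [right; eauto |]. clear k M HM. intros X [HX | (k & M & -> & HM)].
  { apply Lam001_spine in HX. revert HX. apply spine001_mono. auto. }
  apply Lam001_spine in HM. revert k. induction HM as [n | M _ IH | M M' _ IH HM']; intros k.
  - rewrite subst_var. destruct (n =? k); [| destruct (n <? k); constructor].
    apply (Lam001_shift k 0), Lam001_spine in HN. revert HN. apply spine001_mono. auto.
  - rewrite subst_lam. constructor. auto.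
  - rewrite subst_app. constructor; eauto 6.
Qed.

Lemma Lam001_hstep M M' : hstep M M' -> Lam001 M -> Lam001 M'.
Proof.
  intros H HM. apply Lam001_spine in HM. induction H as [P Q | M M' _ IH | M M' Q _ _ IH].
  - inversion HM as [| | ? ? H1 H2]; subst. inversion H1 as [| ? H3 |]; subst.
    apply Lam001_subst; [assumption | apply Lam001_spine; assumption].
  - inversion HM; subst. apply Lam001_spine. constructor. apply Lam001_spine. auto.
  - inversion HM; subst. apply Lam001_spine. constructor; [apply Lam001_spine |]; auto.
Qed.

Lemma teq_refl M : teq M M.
Proof. revert M. cofix IH. intros [n | P | P Q]; constructor; apply IH. Qed.

Lemma hstep_bstep M M' : hstep M M' -> bstep M M'.
Proof. induction 1; constructor; assumption. Qed.

Lemma hred_bred M N : hred M N -> bred M N.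
Proof.
  induction 1; [constructor; assumption |].
  econstructor; [apply hstep_bstep; eassumption | assumption].
Qed.

(** The given reduction is spent at the root, and the derivation then copies [N] with empty
    reductions. Finiteness of the spines of [N] keeps the inductive part of the derivation
    finite. *)
Lemma infred_of_bred M N : bred M N -> Lam001 N -> infred M N.
Proof.
  intros H HN. exists (fun M N => bred M N /\ Lam001 N). split; [auto |].
  clear. intros M N [H HN]. apply Lam001_spine in HN. revert M H.
  induction HN as [n | N _ IH | N N' _ IH HN']; intros M H.
  - constructor. assumption.
  - apply inf_lam with N; [assumption |]. apply IH. apply bred_refl, teq_refl.
  - apply inf_app with N N'; [assumption | |].
    + apply IH. apply bred_refl, teq_refl.
    + split; [apply bred_refl, teq_refl | assumption].
Qed.

(** * Taylor approximation *)

Lemma taylor_teq s M M' : teq M M' -> taylor s M' -> taylor s M.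
Proof.
  intros E H. revert M E.
  induction s as [n | s IH | s ts IH IHts] using rterm_nested_ind in M', H |- *; intros M E;
    inversion H; subst; inversion E; subst; constructor; eauto.
  rewrite Forall_forall in IHts. eauto.
Qed.

Lemma taylor_rshift d s : forall c M, taylor s M -> taylor (rshift d c s) (shift d c M).
Proof.
  induction s as [n | s IH | s ts IH IHts] using rterm_nested_ind; intros c M H;
    inversion H; subst.
  - rewrite shift_var. constructor.
  - rewrite shift_lam. constructor. auto.
  - rewrite shift_tapp, rshift_app. constructor; [auto |].
    intros t Ht. apply in_map_iff in Ht as (t' & <- & Ht').
    rewrite Forall_forall in IHts. auto.
Qed.

Lemma Forall2_choose (P : rterm -> Prop) (Q : rterm -> rterm -> Prop) ts :
  (forall t, In t ts -> exists t', P t' /\ Q t' t) ->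
  exists ts', Forall P ts' /\ Forall2 Q ts' ts.
Proof.
  induction ts as [| t ts IH]; intros H; [exists []; auto |].
  destruct (H t) as (t' & H1 & H2); [left; reflexivity |].
  destruct IH as (ts' & H3 & H4); [intros; apply H; right; assumption |].
  exists (t' :: ts'). auto.
Qed.

Lemma taylor_shift_inv d s : forall c M, taylor s (shift d c M) ->
  exists t, taylor t M /\ rshift d c t = s.
Proof.
  induction s as [n | s IH | s ts IH IHts] using rterm_nested_ind; intros c M H.
  - destruct M as [m | M | M N]; [rewrite shift_var in H | rewrite shift_lam in H |
      rewrite shift_tapp in H]; inversion H; subst.
    exists (rvar m). split; [constructor | reflexivity].
  - destruct M as [m | M | M N]; [rewrite shift_var in H | rewrite shift_lam in H |
      rewrite shift_tapp in H]; inversion H; subst.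
    destruct (IH (S c) M) as (t & Ht & <-); [assumption |].
    exists (rlam t). split; [constructor; assumption | reflexivity].
  - destruct M as [m | M | M N]; [rewrite shift_var in H | rewrite shift_lam in H |
      rewrite shift_tapp in H]; inversion H as [| | ? ? ? ? H1 H2]; subst.
    destruct (IH c M H1) as (t & Ht & <-). rewrite Forall_forall in IHts.
    destruct (Forall2_choose (fun t => taylor t N) (fun t' t => rshift d c t' = t) ts)
      as (ts' & H3 & H4); [auto |].
    exists (rapp t ts'). rewrite Forall_forall in H3. split; [constructor; assumption |].
    rewrite rshift_app. f_equal. clear - H4. induction H4; cbn; congruence.
Qed.

Lemma taylor_subst N :
  (forall k s p c, lin_subst k s p c -> forall M, taylor s M ->
     Forall (fun t => taylor t N) p -> taylor c (subst k N M)) /\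
  (forall k ts p cs, lin_substs k ts p cs -> forall M,
     (forall t, In t ts -> taylor t M) -> Forall (fun t => taylor t N) p ->
     forall c, In c cs -> taylor c (subst k N M)).
Proof.
  apply lin_subst_mutind.
  - intros k t M H Hp. inversion H; subst. rewrite subst_var, Nat.eqb_refl.
    apply taylor_rshift. inversion Hp; assumption.
  - intros k n Hn M H _. inversion H; subst. rewrite subst_var.
    apply Nat.eqb_neq in Hn. rewrite Hn. destruct (n <? k); constructor.
  - intros k s p c _ IH M H Hp. inversion H; subst. rewrite subst_lam. constructor. auto.
  - intros k s ts p p1 p2 c cs _ IH1 _ IH2 Hp M H HN. inversion H; subst.
    rewrite Hp, Forall_app in HN. destruct HN. rewrite subst_app. constructor; eauto.
  - intros k M _ _ c [].
  - intros k s ts p p1 p2 c cs _ IH1 _ IH2 Hp M H HN c' Hc'.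
    rewrite Hp, Forall_app in HN. destruct HN.
    destruct Hc' as [<- | Hc'].
    + apply IH1; [apply H; left; reflexivity | assumption].
    + apply IH2; [intros; apply H; right; assumption | assumption | assumption].
Qed.

(** An approximant is finite, so it meets only finitely many copies of [N]; its parts inside them
    form the bag [p]. *)
Lemma taylor_subst_inv N c : forall k M, taylor c (subst k N M) ->
  exists s p, taylor s M /\ Forall (fun t => taylor t N) p /\ lin_subst k s p c.
Proof.
  (* When [M] is a variable, [c] may have any shape, so this case occurs in every branch of the
     induction on [c]. *)
  assert (Hvar : forall k m c, taylor c (subst k N (var m)) ->
    exists s p, taylor s (var m) /\ Forall (fun t => taylor t N) p /\ lin_subst k s p c).
  { clear. intros k m c H. rewrite subst_var in H. destruct (Nat.eqb_spec m k) as [-> | Hm].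
    - apply taylor_shift_inv in H as (t & Ht & <-). exists (rvar k), [t].
      repeat constructor. assumption.
    - exists (rvar m), []. split; [constructor |]. split; [constructor |].
      assert (c = rvar (if m <? k then m else pred m)) as ->
        by (destruct (m <? k); inversion H; reflexivity).
      constructor. assumption. }
  induction c as [n | c IH | c cs IH IHcs] using rterm_nested_ind; intros k [m | M | M M'] H;
    try (apply Hvar; assumption);
    rewrite ?subst_lam, ?subst_app in H; inversion H as [| | ? ? ? ? H1 H2]; subst.
  - destruct (IH (S k) M) as (s & p & Hs & Hp & Hc); [assumption |].
    exists (rlam s), p. repeat split; [constructor; assumption | assumption |
      constructor; assumption].
  - destruct (IH k M H1) as (s & p & Hs & Hp & Hc).
    assert (exists ss q, (forall t, In t ss -> taylor t M') /\
        Forall (fun t => taylor t N) q /\ lin_substs k ss q cs) as (ss & q & Hss & Hq & Hcs).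
    { clear - IHcs H2. induction IHcs as [| c cs IHc _ IH].
      - exists [], []. repeat split; [intros ? [] | constructor | constructor].
      - destruct (IHc k M') as (s & p & Hs & Hp & Hc); [apply H2; left; reflexivity |].
        destruct IH as (ss & q & Hss & Hq & Hcs); [intros; apply H2; right; assumption |].
        exists (s :: ss), (p ++ q). repeat split.
        + intros t [<- | Ht]; auto.
        + apply Forall_app. auto.
        + econstructor; [eassumption | eassumption | reflexivity]. }
    exists (rapp s ss), (p ++ q). repeat split.
    + constructor; assumption.
    + apply Forall_app. auto.
    + econstructor; [eassumption | eassumption | reflexivity].
Qed.

(** A step in an argument has to be pulled back in each member of the corresponding bag, so one beta
    step may cost several resource steps, or none. *)
Lemma taylor_bstep_expand M M' : bstep M M' -> forall t, taylor t M' ->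
  exists s, taylor s M /\ rtos s t.
Proof.
  induction 1 as [P Q | M M' _ IH | M M' N _ IH | M N N' _ IH]; intros t Ht.
  - apply taylor_subst_inv in Ht as (s & p & Hs & Hp & Hc). rewrite Forall_forall in Hp.
    exists (rapp (rlam s) p). split; [repeat constructor; assumption |].
    apply rt_step. constructor. assumption.
  - inversion Ht; subst. destruct (IH s) as (u & Hu & Hr); [assumption |].
    exists (rlam u). split; [constructor; assumption | apply rtos_lam; assumption].
  - inversion Ht; subst. destruct (IH s) as (u & Hu & Hr); [assumption |].
    exists (rapp u ts). split; [constructor; assumption | apply rtos_appl; assumption].
  - inversion Ht; subst.
    destruct (Forall2_choose (fun t => taylor t N) rtos ts) as (us & Hus & Hr); [auto |].
    rewrite Forall_forall in Hus.
    exists (rapp s us). split; [constructor; assumption | apply rtos_bag; assumption].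
Qed.

Lemma taylor_bred_expand M N : bred M N -> forall t, taylor t N ->
  exists s, taylor s M /\ rtos s t.
Proof.
  induction 1 as [M N E | M M' N H _ IH]; intros t Ht.
  - exists t. split; [eapply taylor_teq; eassumption | apply rt_refl].
  - destruct (IH t Ht) as (u & Hu & Hut).
    destruct (taylor_bstep_expand _ _ H _ Hu) as (s & Hs & Hsu).
    exists s. split; [assumption | eapply rt_trans; eassumption].
Qed.

(** * Head normal forms through approximants *)

Lemma taylor_rhnf s M : taylor s M -> rhnf s -> hnf M.
Proof.
  assert (Hv : forall s, rhead_var s -> forall M, taylor s M -> head_var M).
  { induction 1; intros M' H'; inversion H'; subst; constructor; auto. }
  intros Ht Hs. revert M Ht. induction Hs as [s _ IH | s Hs]; intros M Ht.
  - inversion Ht; subst. constructor. auto.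
  - apply hnf_hv. eapply Hv; eassumption.
Qed.

(** A head step lies outside all bags and so matches a single step of [M]. The side condition on
    applications transfers because every approximant of an abstraction is an abstraction. *)
Lemma taylor_rhto s t M : rhto s t -> taylor s M ->
  exists M', hstep M M' /\ taylor t M'.
Proof.
  intros H. revert M. induction H as [s ts c Hc | s t _ IH | s t ts Hs _ IH]; intros M HM.
  - inversion HM as [| | ? ? P Q H1 H2]; subst. inversion H1; subst.
    eexists. split; [constructor |].
    apply (taylor_subst Q) with (s := s) (p := ts); [assumption | assumption |].
    apply Forall_forall. assumption.
  - inversion HM as [| ? P HP |]; subst. destruct (IH P HP) as (M' & H1 & H2).
    exists (lam M'). split; constructor; assumption.
  - inversion HM as [| | ? ? P Q H1 H2]; subst. destruct (IH P H1) as (M' & H3 & H4).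
    exists (app M' Q). split; constructor; [| assumption | assumption | assumption].
    intros P' ->. inversion H1; subst. eapply Hs. reflexivity.
Qed.

(** Head reduction of the possibly infinite [M] is measured by the size of its finite approximant,
    which each head step decreases. *)
Lemma hred_hnf_of_rtos s u : rtos s u -> rhnf u -> forall M, taylor s M -> Lam001 M ->
  exists N, Lam001 N /\ hnf N /\ hred M N.
Proof.
  revert u. induction s as [s IH] using (well_founded_induction (well_founded_ltof _ rsize)).
  intros u Hsu Hu M Hs HM.
  destruct (rtos_rhnf_head_first _ _ Hsu Hu) as [Hn | (t & Hst & Htu)].
  - exists M. repeat split; [assumption | eapply taylor_rhnf; eassumption |].
    apply hred_refl, teq_refl.
  - destruct (taylor_rhto _ _ _ Hst Hs) as (M' & HMM' & Ht).
    destruct (IH t (rto_rsize _ _ (rhto_rto _ _ Hst)) u Htu Hu M' Ht) as (N & H1 & H2 & H3).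
    { eapply Lam001_hstep; eassumption. }
    exists N. repeat split; [assumption | assumption | econstructor; eassumption].
Qed.

(** With an empty bag at each application of the head spine, nothing has to be known about the
    arguments, and induction on that finite spine suffices. The last conjunct ensures that applying
    [u] to an empty bag creates no redex. *)
Lemma infstep_head_var_approx R M N : infstep R M N -> head_var N ->
  exists s u, taylor s M /\ rtos s u /\ (forall T, ~ rstep u T) /\ forall v, u <> rlam v.
Proof.
  intros H HN. revert M H. induction HN as [n | N N' _ IH]; intros M H.
  - inversion H as [? ? Hb | |]; subst.
    destruct (taylor_bred_expand _ _ Hb (rvar n)) as (s & Hs & Hr); [constructor |].
    exists s, (rvar n). repeat split; auto; [intros T HT; inversion HT | discriminate].
  - inversion H as [| | ? P Q ? ? Hb HP _]; subst.
    destruct (IH P HP) as (s & u & Hs & Hr & Hu & Hv).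
    (* The approximant of [P] becomes one of [app P Q] by adding an empty bag, and is then pulled
       back along the finite reduction from [M]. *)
    destruct (taylor_bred_expand _ _ Hb (rapp s [])) as (s' & Hs' & Hr').
    { constructor; [assumption | intros ? []]. }
    exists s', (rapp u []). split; [assumption |]. split; [| split; [| discriminate]].
    + eapply rt_trans; [eassumption | apply rtos_appl; assumption].
    + intros T HT. inversion HT as [| | | ? ts1 t ts2 ? ? E]; subst.
      * eapply Hv. reflexivity.
      * eapply Hu. eassumption.
      * destruct ts1; discriminate.
Qed.

Lemma infstep_hnf_approx R M N : infstep R M N -> hnf N ->
  exists s u, taylor s M /\ rtos s u /\ forall T, ~ rstep u T.
Proof.
  intros H HN. revert M H. induction HN as [N _ IH | N HN]; intros M H.
  - inversion H as [| ? P ? Hb HP |]; subst.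
    destruct (IH P HP) as (s & u & Hs & Hr & Hu).
    destruct (taylor_bred_expand _ _ Hb (rlam s)) as (s' & Hs' & Hr').
    { constructor. assumption. }
    exists s', (rlam u). split; [assumption |]. split.
    + eapply rt_trans; [eassumption | apply rtos_lam; assumption].
    + intros T HT. inversion HT; subst. eapply Hu. eassumption.
  - destruct (infstep_head_var_approx _ _ _ H HN) as (s & u & Hs & Hr & Hu & _). eauto.
Qed.

Theorem mainTheorem10 : forall M : term, Lam001 M ->
  ((exists N, Lam001 N /\ hnf N /\ infred M N) <->
   (exists s, taylor s M /\ exists S, nf_r s S /\ S <> nil))
  /\
  ((exists s, taylor s M /\ exists S, nf_r s S /\ S <> nil) <->
   (exists N, Lam001 N /\ hnf N /\ hred M N)).
Proof.
  intros M HM.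
  (* Three implications forming a cycle yield both equivalences. *)
  assert (inf_nf : (exists N, Lam001 N /\ hnf N /\ infred M N) ->
    exists s, taylor s M /\ exists S, nf_r s S /\ S <> nil).
  { intros (N & _ & HN & R & HR & Hinf).
    destruct (infstep_hnf_approx R M N) as (s & u & Hs & Hr & Hu); [auto | assumption |].
    exists s. split; [assumption | eapply nf_r_nonempty_of_rtos; eassumption]. }
  assert (nf_head : (exists s, taylor s M /\ exists S, nf_r s S /\ S <> nil) ->
    exists N, Lam001 N /\ hnf N /\ hred M N).
  { intros (s & Hs & S & (HR & HN) & HS).
    destruct S as [| u S]; [destruct HS; reflexivity |].
    destruct (sred_star_rtos _ _ u HR) as (s' & [<- | []] & Hr); [left; reflexivity |].
    apply hred_hnf_of_rtos with s u; [assumption | | assumption | assumption].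
    apply rhnf_of_normal, HN. left. reflexivity. }
  assert (head_inf : (exists N, Lam001 N /\ hnf N /\ hred M N) ->
    exists N, Lam001 N /\ hnf N /\ infred M N).
  { intros (N & HL & HN & HR). exists N. repeat split; [assumption | assumption |].
    apply infred_of_bred; [apply hred_bred |]; assumption. }
  tauto.
Qed.
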